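(* Let $q$ be a prime power, and let $C_q\le S_q$ be a cyclic group of order $q$ (acting regularly on $q$ points). Then for all integers $k,d\ge1$, \[ \mathcal L^{C_q^{k-1}}_{\mathsf{AC}}(\textsc{Word}_{C_q,k})\ \ge\ q^{\log_2 k},\qquad \mathcal L^{C_q^{k-1}}_{\mathsf{AC}_d}(\textsc{Word}_{C_q,k})\ \ge\ q^{d(k^{1/d}-1)}. \]
   Context: Word problem. For $G\le S_n$, let $\overline G$ be the set of permutation matrices of elements of $G$, and view $\overline G^k\subseteq\{0,1\}^{kn^2}$ with variables $M_{i,a,b}$ (entry $(a,b)$ of the $i$-th matrix). $\textsc{Word}_{G,k}:\overline G^k\to\{0,1\}$ outputs the $(1,1)$-entry of $M_1\cdots M_k$. The group $G^{k-1}$ acts faithfully on variables by $(g_1,\dots,g_{k-1})\cdot M_{i,a,b}=M_{i,g_{i-1}(a),g_i(b)}$ with $g_0=g_k=1$, i.e. $(M_1,\dots,M_k)\mapsto(M_1\overline{g_1}^{-1},\overline{g_1}M_2\overline{g_2}^{-1},\dots,\overline{g_{k-1}}M_k)$. Thus $G^{k-1}\le S_{kn^2}$. Formulas. An $\mathsf{AC}$ formula over $x_1,\dots,x_m$ is a finite rooted tree with unordered children. Leaves are labeled $0,1,x_i,\neg x_i$, and gates are unbounded fan-in $\textsc{and}$ or $\textsc{or}$. Formulas are considered up to labeled-tree isomorphism. Depth is the maximum number of gates on a root-leaf path; size is the number of literal leaves. $S_m$ acts by relabeling literal indices, and $\Phi$ is $P$-invariant ($P\le S_m$) if $\pi\Phi=\Phi$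 for all $\pi\in P$. $\mathcal L^P_{\mathsf{AC}_d}(f)$ (resp. $\mathcal L^P_{\mathsf{AC}}(f)$) is the minimum size of a $P$-invariant $\mathsf{AC}$ formula of depth at most $d$ (resp. any depth) agreeing with $f$ on its domain. *)

(* Defs.v *)
From mathcomp Require Import all_boot all_fingroup cyclic.
From Stdlib Require List Permutation.


Set Implicit Arguments.
Unset Strict Implicit.
Unset Printing Implicit Defensive.

(* Leaves: constants 0/1 (FConst), literals x_v (FLit v true), ~x_v (FLit v false).
   Gates: unbounded fan-in AND / OR; children are a list, considered up to
   reordering via the isomorphism relation [fiso] below. *)
Inductive formula (V : Type) : Type :=
| FConst of bool
| FLit of V & bool
| FAnd of seq (formula V)
| FOr of seq (formula V).

Arguments FConst {V}.

Section Formulas.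
Variable V : Type.

Fixpoint fsize (f : formula V) : nat :=
  match f with
  | FConst _ => 0
  | FLit _ _ => 1
  | FAnd l => sumn (map fsize l)
  | FOr l => sumn (map fsize l)
  end.

Fixpoint fdepth (f : formula V) : nat :=
  match f with
  | FConst _ => 0
  | FLit _ _ => 0
  | FAnd l => (foldr maxn 0 (map fdepth l)).+1
  | FOr l => (foldr maxn 0 (map fdepth l)).+1
  end.

Fixpoint feval (x : V -> bool) (f : formula V) : bool :=
  match f with
  | FConst b => b
  | FLit v s => if s then x v else ~~ x v
  | FAnd l => all (feval x) l
  | FOr l => has (feval x) l
  end.

Fixpoint frename (s : V -> V) (f : formula V) : formula V :=
  match f with
  | FConst b => FConst b
  | FLit v b => FLit (s v) b
  | FAnd l => FAnd (map (frename s) l)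
  | FOr l => FOr (map (frename s) l)
  end.

Inductive fiso : formula V -> formula V -> Prop :=
| fiso_const b : fiso (FConst b) (FConst b)
| fiso_lit v s : fiso (FLit v s) (FLit v s)
| fiso_and l1 l2 l3 :
    Permutation.Permutation l2 l3 -> List.Forall2 fiso l1 l3 ->
    fiso (FAnd l1) (FAnd l2)
| fiso_or l1 l2 l3 :
    Permutation.Permutation l2 l3 -> List.Forall2 fiso l1 l3 ->
    fiso (FOr l1) (FOr l2).

End Formulas.

(* Variable M_{i,a,b}: i : 'I_k is the (0-based) index of the matrix
   (i = 0 is M_1), a b : 'I_q are row/column (0-based, so (1,1) is (0,0)). *)
Definition wvar (k q : nat) : Type := ('I_k * 'I_q * 'I_q)%type.

(* matrix entries as a nat-indexed family (out of range -> 0) *)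
Definition wentry (k q : nat) (x : wvar k q -> bool) (i : nat) (a b : 'I_q) : bool :=
  match insub i with Some i' => x (i', a, b) | None => false end.

(* row vector e_1^T M_1 ... M_m (boolean matrix product) *)
Fixpoint wrow (k q : nat) (x : wvar k q -> bool) (m : nat) : 'I_q -> bool :=
  match m with
  | 0 => fun a => val a == 0
  | m'.+1 => fun b => [exists a, wrow x m' a && wentry x m' a b]
  end.

(* (1,1)-entry of M_1 ... M_k *)
Definition word (k q : nat) (x : wvar k q -> bool) : bool :=
  [exists b : 'I_q, (val b == 0) && wrow x k b].

Definition permmx_assign (k q : nat) (h : 'I_k -> {perm 'I_q}) (v : wvar k q) : bool :=
  let: (i, a, b) := v in h i a == b.

Definition gext (k q : nat) (g : nat -> {perm 'I_q}) (j : nat) : {perm 'I_q} :=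
  if (0 < j) && (j < k) then g j else 1%g.

(* action of (g_1,...,g_{k-1}) on variables: M_{i,a,b} |-> M_{i,g_{i-1}(a),g_i(b)}
   (1-based matrix index i, here 0-based i corresponds to matrix i+1) *)
Definition wact (k q : nat) (g : nat -> {perm 'I_q}) (v : wvar k q) : wvar k q :=
  let: (i, a, b) := v in (i, gext k g i a, gext k g i.+1 b).

Definition word_invariant (k q : nat) (G : {set {perm 'I_q}}) (f : formula (wvar k q)) : Prop :=
  forall g : nat -> {perm 'I_q}, (forall j, 0 < j < k -> g j \in G) ->
    fiso (frename (wact g) f) f.

Definition computes_word (k q : nat) (G : {set {perm 'I_q}}) (f : formula (wvar k q)) : Prop :=
  forall h : 'I_k -> {perm 'I_q}, (forall i, h i \in G) ->
    feval (permmx_assign h) f = word (permmx_assign h).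

Definition prime_power (q : nat) : Prop :=
  exists p e : nat, prime p /\ 0 < e /\ q = p ^ e.

(* Main.v *)
Require Import Defs.
From Stdlib Require Import Reals Lra.
From mathcomp Require Import all_boot all_fingroup all_order all_algebra all_solvable.
From mathcomp Require Import boolp zify lra.

(** Write [q = p ^ e] and identify the inputs with the abelian [p]-group [G ^ k];
the symmetry group is the subgroup of tuples with product [1], acting by
translation. If [U] stabilizes a subformula and [U'] is the stabilizer in [U] of
one of its children, the subformula is at least [#|U : U'|] times as large as the
child. Moreover, if an AND/OR gate separates two inputs [x], [y], then some child
separates one of them from the whole [U]-coset of the other, so along a path to a
leaf the difference [w] of the two inputs may be modified by elements of [U].
We keep [w] of order [p] and use this freedom to make the path expensive.

The cost [#|U : U'|] is split into [e] layers, the drops [c t] of the dimensions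
of ['Ohm_1('Mho^t(U))]. With a weight [mu t] per layer we maintain that on each
set of coordinates (away from a set [Z] on which [w] is trivial) the weighted
number of linear constraints satisfied by the layers is at most the number of
coordinates. Passing to a child, [mu t] is divided by [c t + 1]; if the
invariant breaks, then [w] can be moved to be trivial on a worst offending set
of coordinates, which is added to [Z]. The weights start at [k / e], and at a
literal their sum is at most [1], so by AM-GM the numbers [c t + 1] along the
path multiply to at least [k ^ e], while [p] to the sum of the [c t] bounds the
size from below. Both bounds follow: [c + 1 <= 2 ^ c], respectively AM-GM. *)

Set Implicit Arguments.
Unset Strict Implicit.
Unset Printing Implicit Defensive.
Import Order.TTheory GRing.Theory Num.Theory GroupScope.

(** * Layers of an abelian p-group *)

Section Layers.
Variables (gT : finGroupType) (p : nat).
Implicit Types (G H K U : {group gT}) (t : nat).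

Definition layer t U := 'Ohm_1('Mho^t(U)).
Canonical layer_group t U := Eval hnf in [group of layer t U].

Lemma layer_sub t U : layer t U \subset U.
Proof. exact: subset_trans (Ohm_sub _ _) (Mho_sub _ _). Qed.

Lemma layerS t U H : U \subset H -> layer t U \subset layer t H.
Proof. by move=> sUH; apply/OhmS/MhoS. Qed.

Lemma layer_sub0 t U : layer t U \subset layer 0 U.
Proof. exact/OhmS/Mho_leq. Qed.

Lemma logn_cardMI H K : logn p #|H| + logn p #|K|
  = logn p #|H * K| + logn p #|H :&: K|.
Proof.
have HKgt0 : 0 < #|H * K| by apply/card_gt0P; exists 1; rewrite -[1]mulg1 mem_mulg.
by rewrite -!lognM ?cardG_gt0 // mul_cardG.
Qed.

Lemma leq_logn_card H K : K \subset H -> logn p #|K| <= logn p #|H|.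
Proof. by move=> sKH; rewrite dvdn_leq_log ?cardG_gt0 ?cardSg. Qed.

(** The quotient of [H :&: K] by [H' :&: K] embeds into [H / H'], so intersecting with [K] cannot
    enlarge an index. *)
Lemma logn_cardI_leq H H' K : abelian H -> H' \subset H ->
  logn p #|H'| + logn p #|H :&: K| <= logn p #|H| + logn p #|H' :&: K|.
Proof.
move=> cHH sH'H; rewrite logn_cardMI.
rewrite setIA (setIidPl sH'H) leq_add2r -norm_joinEr; last first.
  by rewrite cents_norm // (sub_abelian_cent2 cHH) ?subsetIl.
by rewrite leq_logn_card // join_subG sH'H subsetIl.
Qed.

Lemma Mho1_Mho t U : p.-group U -> abelian U -> 'Mho^1('Mho^t(U)) = 'Mho^t.+1(U).
Proof.
move=> pU cUU; have pM : p.-group 'Mho^t(U) := pgroupS (Mho_sub _ _) pU.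
have cM : abelian 'Mho^t(U) := abelianS (Mho_sub _ _) cUU.
rewrite (MhoEabelian 1 pM cM) (MhoEabelian t.+1 pU cUU).
have Mt y : (y \in 'Mho^t(U)) = (y \in [set x ^+ (p ^ t) | x in U]).
  by rewrite (MhoEabelian t pU cUU).
apply/setP=> x; apply/imsetP/imsetP => [[y0]|[y Uy ->]].
  by rewrite Mt => /imsetP[y Uy ->] ->; exists y; rewrite // -expgM expn1 -expnSr.
exists (y ^+ (p ^ t)); first by rewrite Mt; apply/imsetP; exists y.
by rewrite -expgM expn1 -expnSr.
Qed.

(** ['Ohm_1] and ['Mho^1] are the kernel and the image of the [p]-th power map, so layer [t]
    accounts for the drop from ['Mho^t(U)] to ['Mho^t.+1(U)]; the exponent ends the telescope at
    [e]. *)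
Lemma logn_card_layers e U : p.-group U -> abelian U ->
  (forall u, u \in U -> u ^+ (p ^ e) = 1) ->
  logn p #|U| = \sum_(t < e) logn p #|layer t U|.
Proof.
move=> pU cUU expU.
have step n : logn p #|U| = \sum_(t < n) logn p #|layer t U| + logn p #|'Mho^n(U)|.
  elim: n => [|n IH]; first by rewrite big_ord0 Mho0.
  rewrite IH big_ord_recr /= -addnA; congr (_ + _)%N.
  rewrite -(mul_card_Ohm_Mho_abelian 1 (abelianS (Mho_sub n U) cUU)).
  by rewrite lognM ?cardG_gt0 // Mho1_Mho.
suff tM : 'Mho^e(U) = 1 by rewrite (step e) tM cards1 logn1 addn0.
apply/trivgP; rewrite /= (MhoEabelian e pU cUU).
by apply/subsetP=> _ /imsetP[u Uu ->]; rewrite expU ?inE.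
Qed.

End Layers.

(** * Coordinate constraints in powers of a cyclic p-group *)

Section Power.
Variables (gT : finGroupType) (p e k : nat) (G : {group gT}).
Hypotheses (p_pr : prime p) (cG : cyclic G) (oG : #|G| = (p ^ e)%N) (e_gt0 : 0 < e).
Notation gTk := {dffun forall _ : 'I_k, gT}.
Implicit Types (S Z : {set 'I_k}) (U : {group gTk}) (u w : gTk).

Definition Gk := setXn (fun _ : 'I_k => G).
Canonical Gk_group := Eval hnf in [group of Gk].

(** As ['Ohm_1(G)] has order [p], this is a vector space over the field of [p] elements, with one
    dimension for each coordinate outside [S]. *)
Definition socle S :=
  setXn (fun i : 'I_k => (if i \in S then 1 else 'Ohm_1(G))%G).
Canonical socle_group S := Eval hnf in [group of socle S].

Let pG : p.-group G.
Proof. by rewrite /pgroup oG pnatX pnat_id. Qed.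

Let abG : abelian G := cyclic_abelian cG.

Lemma socleP S u :
  reflect ((forall i, u i \in 'Ohm_1(G)) /\ (forall i, i \in S -> u i = 1))
          (u \in socle S).
Proof.
apply: (iffP setXnP) => [Su|[Ou Su] i].
  split=> i => [|Si]; have := Su i; last by rewrite Si inE => /eqP.
  by case: ifP => // _; rewrite inE => /eqP->; apply: group1.
by case: ifP => Si; rewrite ?Ou // Su ?inE.
Qed.

Lemma socleS S Z : Z \subset S -> socle S \subset socle Z.
Proof.
move=> sZS; apply/subsetP=> u /socleP[Ou Su]; apply/socleP; split=> // i Zi.
by rewrite Su // (subsetP sZS).
Qed.

Lemma card_Ohm1G : #|'Ohm_1(G)| = p.
Proof.
apply: Ohm1_cyclic_pgroup_prime => //.
by rewrite trivg_card1 oG -(expn0 p) eqn_exp2l ?prime_gt1 // -lt0n.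
Qed.

Lemma card_socle S : #|socle S| = (p ^ #|~: S|)%N.
Proof.
rewrite cardsXn (bigID [in S]) /= big1 => [|i ->]; last by rewrite cards1.
rewrite mul1n (eq_bigr (fun=> p)) => [|i /negPf->]; last exact: card_Ohm1G.
by rewrite prod_nat_const; congr (_ ^ _)%N; apply: eq_card => i; rewrite !inE.
Qed.

Lemma Gk_abelian : abelian Gk.
Proof.
apply/centsP=> x /setXnP Gx y /setXnP Gy; apply/ffunP=> i; rewrite !ffunE.
exact: (centsP abG).
Qed.

Lemma card_Gk : #|Gk| = (p ^ (e * k))%N.
Proof. by rewrite cardsXn prod_nat_const oG card_ord expnM. Qed.

Lemma Gk_pgroup : p.-group Gk.
Proof. by rewrite /pgroup card_Gk pnatX pnat_id. Qed.

Lemma expgn_ffun n u i : (u ^+ n) i = u i ^+ n.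
Proof. by elim: n => [|n IH]; rewrite ?expg0 ?ffunE // !expgS ffunE IH. Qed.

Lemma Gk_exponent u : u \in Gk -> u ^+ (p ^ e) = 1.
Proof. by move=> Gu; apply/ffunP=> i; rewrite expgn_ffun ffunE -oG expg_cardG ?(setXnP Gu). Qed.

Lemma socle_sub_Gk S : socle S \subset Gk.
Proof.
apply/subsetP=> u /socleP[Ou _]; apply/setXnP=> i.
exact: subsetP (Ohm_sub 1 G) _ (Ou i).
Qed.

Lemma Ohm1_Gk : 'Ohm_1(Gk) = socle set0.
Proof.
rewrite (OhmEabelian Gk_pgroup) ?(abelianS (Ohm_sub _ _) Gk_abelian) //.
have OG := OhmEabelian pG (abelianS (Ohm_sub 1 G) abG).
apply/setP=> u; apply/LdivP/socleP => [[/setXnP Gu pu]|[Ou _]].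
  split=> i; last by rewrite inE.
  by rewrite OG; apply/LdivP; rewrite -expgn_ffun pu ffunE.
split; first by apply/(subsetP (socle_sub_Gk set0))/socleP; split=> // i; rewrite inE.
apply/ffunP=> i; rewrite expgn_ffun ffunE.
by have := Ou i; rewrite OG => /LdivP[].
Qed.

Lemma layer_sub_socle t U : U \subset Gk -> layer t U \subset socle set0.
Proof.
move=> sU; rewrite -Ohm1_Gk -[Gk]Mho0; exact: subset_trans (layer_sub0 t U) (OhmS _ (MhoS _ sU)).
Qed.

(** * Dimensions of the subspaces of a layer that vanish on given coordinates *)

Definition fixdim t U S := logn p #|layer t U :&: socle S|.

Lemma fixdim0 t U : U \subset Gk -> fixdim t U set0 = logn p #|layer t U|.
Proof. by move=> sU; rewrite /fixdim (setIidPl (layer_sub_socle t sU)). Qed.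

Lemma fixdim_mono t (U U' : {group gTk}) S : U' \subset U -> fixdim t U' S <= fixdim t U S.
Proof. by move=> sU; apply: leq_logn_card; rewrite setSI ?layerS. Qed.

Lemma fixdim_drop t (U U' : {group gTk}) S : U \subset Gk -> U' \subset U ->
  fixdim t U S <= fixdim t U' S + (fixdim t U set0 - fixdim t U' set0).
Proof.
move=> sU sU'; rewrite !fixdim0 ?(subset_trans sU') // addnBA; last first.
  by rewrite leq_logn_card // layerS.
rewrite leq_subRL; last first.
  by rewrite (leq_trans (leq_logn_card _ (layerS t sU'))) // leq_addl.
rewrite [X in _ <= X]addnC logn_cardI_leq ?layerS //.
exact: abelianS (subset_trans (layer_sub _ _) sU) Gk_abelian.
Qed.

(** If the vectors of layer [t] vanishing on [Z] spanned [socle Z] together with [socle S], one of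
    them would carry [w] into [socle S]. So the span is proper, and the strict inequality is its
    dimension count. *)
Lemma fixdim_deficient t U S Z w : U \subset Gk -> Z \subset S -> w \in socle Z ->
  (forall u, u \in layer 0 U -> u \in socle Z -> w * u \notin socle S) ->
  fixdim t U Z < fixdim t U S + #|S :\: Z|.
Proof.
move=> sU sZS Zw unmatched.
pose X := (layer t U :&: socle Z)%G.
have cXS : commute X (socle S).
  apply/commute_sym/centC; apply: (sub_abelian_cent2 Gk_abelian (socle_sub_Gk S)).
  exact: subset_trans (subsetIr _ _) (socle_sub_Gk Z).
have sJ : X <*> socle S \proper socle Z.
  rewrite properE join_subG subsetIr socleS //=.
  apply/subsetPn; exists w => //; rewrite comm_joingE //.
  apply/imset2P=> -[u v /setIP[Lu Zu] Sv wuv].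
  (* Layer 0 contains every layer, so one obstruction there serves all [t] at once. *)
  have /negP[] := unmatched u^-1 (groupVr (subsetP (layer_sub0 t U) _ Lu)) (groupVr Zu).
  rewrite wuv (centsP Gk_abelian u _ v) ?mulgK //.
    exact: subsetP (socle_sub_Gk Z) _ Zu.
  exact: subsetP (socle_sub_Gk S) _ Sv.
have ltJ : logn p #|X <*> socle S| < logn p #|socle Z|.
  have pZ : p.-group (socle Z) := pgroupS (socle_sub_Gk Z) Gk_pgroup.
  rewrite -(ltn_exp2l _ _ (prime_gt1 p_pr)) -!card_pgroup ?proper_card //.
  exact: pgroupS (proper_sub sJ) pZ.
have := logn_cardMI p X (socle S); rewrite -comm_joingE //.
rewrite !card_socle !pfactorK // in ltJ *.
rewrite /X /= -setIA (setIidPr (socleS sZS)) -/(fixdim t U Z) -/(fixdim t U S) => eqJ.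
have := cardsC Z; rewrite -(cardsC S) -(cardsID Z S) (setIidPr sZS) -addnA.
move/addnI=> eqZ; rewrite eqZ in ltJ.
by rewrite -(ltn_add2r #|~: S|) eqJ addnC -addnA ltn_add2l.
Qed.


(** * Weighted constraint counts and the balance invariant *)

Local Open Scope ring_scope.

(* [#|S| + fixdim t U S] is, up to the constant [fixdim t U set0], the number of
   independent linear constraints on the coordinates in [S] satisfied by layer [t]. *)
Definition excess U (mu : 'I_e -> rat) S : rat :=
  \sum_t mu t * (#|S| + fixdim t U S)%:R - #|S|%:R.

(** Equivalently, enlarging [Z] to [S] adds at most [#|S :\: Z|] to the weighted number of
    constraints. *)
Definition balanced U mu Z := forall S, Z \subset S -> excess U mu S <= excess U mu Z.

Definition layer_drop (U U' : {group gTk}) (t : nat) : nat :=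
  (fixdim t U set0 - fixdim t U' set0)%N.

Lemma logn_sub_Gk U : U \subset Gk -> (logn p #|U| = \sum_(t < e) fixdim t U set0)%N.
Proof.
move=> sU; rewrite (logn_card_layers (e := e) (pgroupS sU Gk_pgroup) (abelianS sU Gk_abelian)).
  by apply: eq_bigr => t _; rewrite fixdim0.
by move=> u /(subsetP sU)/Gk_exponent.
Qed.

Lemma card_layer_drop (U U' : {group gTk}) : U \subset Gk -> U' \subset U ->
  #|U| = (p ^ (\sum_(t < e) layer_drop U U' t) * #|U'|)%N.
Proof.
move=> sU sU'; have sU'G := subset_trans sU' sU.
rewrite (card_pgroup (pgroupS sU Gk_pgroup)) (card_pgroup (pgroupS sU'G Gk_pgroup)).
rewrite -expnD !logn_sub_Gk // -big_split /=; congr (_ ^ _)%N.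
by apply: eq_bigr => t _; rewrite subnK // fixdim_mono.
Qed.

(** Let [S] maximize the new excess. If [w] can be moved into [socle S], then [S] serves as [Z'] by
    maximality. Otherwise every layer gains at least one constraint from [Z] to [S], and dividing
    [mu t] by the drop plus one compensates for the drop, so [Z] still works. *)
Lemma balanced_step (U U' : {group gTk}) (mu : 'I_e -> rat) Z w :
  U \subset Gk -> U' \subset U -> w \in socle Z -> (forall t, 0 < mu t) ->
  balanced U mu Z ->
  exists u Z', [/\ u \in U, (w * u)%g \in socle Z' &
    balanced U' (fun t => mu t / (layer_drop U U' t).+1%:R) Z'].
Proof.
move=> sU sU' Zw mu_gt0 balU; set mu' : 'I_e -> rat := fun t => _ / _.
pose S := [arg max_(S > Z | Z \subset S) excess U' mu' S]%O.
have [sZS maxS] : Z \subset S /\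
    forall T : {set 'I_k}, Z \subset T -> excess U' mu' T <= excess U' mu' S.
  by rewrite /S; case: arg_maxP.
case: (pselect (exists2 u, u \in layer 0 U & (u \in socle Z) && ((w * u)%g \in socle S))).
  move=> [u Lu /andP[_ Swu]]; exists u, S; split=> //.
    exact: subsetP (layer_sub 0 U) _ Lu.
  by move=> T sST; apply: maxS; apply: subset_trans sST.
move=> unmatched; exists 1%g, Z; split; rewrite ?mulg1 ?group1 // => T sZT.
apply: le_trans (maxS T sZT) _.
have cS : #|S| = (#|Z| + #|S :\: Z|)%N by rewrite -(cardsID Z S) (setIidPr sZS).
(* If layer [t] gains [A >= 1] from [Z] to [S] under [U] and drops by [c], its gain under [U'] is at
   most [A + c <= (c + 1) * A]. *)
suff le_mu t : mu' t * (#|S| + fixdim t U' S)%:R - mu' t * (#|Z| + fixdim t U' Z)%:R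
   <= mu t * (#|S| + fixdim t U S)%:R - mu t * (#|Z| + fixdim t U Z)%:R.
  have := ler_sum (index_enum _) (P := predT) (fun t _ => le_mu t); rewrite !sumrB.
  move: (balU S sZS); rewrite /excess; lra.
have Ldef : (fixdim t U Z < fixdim t U S + #|S :\: Z|)%N.
  apply: fixdim_deficient sU sZS Zw _ => u Lu Zu; apply/negP => Swu.
  by apply: unmatched; exists u; rewrite // Zu.
have LS := fixdim_mono t S sU'; have LZ := fixdim_drop t Z sU sU'.
rewrite -!mulrBr /mu' -mulrA ler_pM2l // ler_pdivrMl ?ltr0n // cS.
rewrite mulrBr lerBlDr addrAC -lerBlDr opprK -!natrM -!natrD ler_nat.
rewrite -/(layer_drop U U' t) in LZ; nia.
Qed.

(** Every layer vanishes at [i], so adding [i] to [Z] raises the weighted count by the sum of the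
    weights and the size by 1. Balance bounds that sum by 1, and AM-GM bounds the product. *)
Lemma balanced_leaf U (mu : 'I_e -> rat) Z i : i \notin Z -> (forall u, u \in U -> u i = 1%g) ->
  (forall t, 0 < mu t) -> balanced U mu Z -> \prod_t (e%:R * mu t) <= 1.
Proof.
move=> nZi Ui mu_gt0 /(_ (i |: Z) (subsetUr _ _)).
have eqf t : fixdim t U (i |: Z) = fixdim t U Z.
  congr (logn p _); apply: eq_card => u; rewrite !(in_setI); apply: andb_id2l => Lu.
  have ui := Ui u (subsetP (layer_sub t U) _ Lu).
  apply/socleP/socleP=> -[Ou Zu]; split=> // j; first by move=> Zj; rewrite Zu ?inE ?Zj ?orbT.
  by rewrite !inE => /predU1P[->|/Zu].
rewrite /excess cardsU1 nZi => bal.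
have sum_mu : \sum_t mu t <= 1.
  have -> : \sum_t mu t = \sum_t mu t * (1 + #|Z| + fixdim t U (i |: Z))%:R
                        - \sum_t mu t * (#|Z| + fixdim t U Z)%:R.
    rewrite -sumrB; apply: eq_bigr => t _.
    by rewrite eqf -mulrBr -addnA natrD addrK mulr1.
  have : ((1 + #|Z|)%:R : rat) = 1 + #|Z|%:R by rewrite natrD.
  by move: bal => /=; lra.
have := leif_AGM (A := 'I_e) (E := mu) (fun t _ => ltW (mu_gt0 t)).
rewrite card_ord => -[AGM _].
rewrite big_split /= prodr_const card_ord.
have e_gt0R : (0 : rat) < e%:R by rewrite ltr0n.
apply: le_trans (ler_wpM2l (exprn_ge0 _ (ltW e_gt0R)) AGM) _.
rewrite -exprMn mulrC mulfVK ?gt_eqF // exprn_ile1 //.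
by apply: sumr_ge0 => t _; apply: ltW.
Qed.

(** * Partial products and the group of words with product 1 *)

(* Coordinates of index at least [k] count as [1]. *)
Fixpoint wprod u n : gT :=
  if n is m.+1 then (wprod u m * (if insub m is Some i then u i else 1))%g else 1%g.

Lemma wprod_in u n : u \in Gk -> wprod u n \in G.
Proof.
move=> /setXnP Gu; elim: n => [|n IH] /=; first exact: group1.
by apply: groupM IH _; case: insub => [i|]; rewrite ?Gu ?group1.
Qed.

Lemma wprodM n : {in Gk &, {morph wprod^~ n : u v / (u * v)%g}}.
Proof.
move=> u v Gu Gv; elim: n => [|n IH] /=; first by rewrite mulg1.
rewrite IH; case: insub => [i|]; last by rewrite !mulg1.
rewrite ffunE !mulgA; congr (_ * _)%g; rewrite -!mulgA; congr (_ * _)%g.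
by apply: (centsP abG); rewrite ?wprod_in ?(setXnP Gu).
Qed.

Canonical wprod_morphism n := Morphism (@wprodM n).

Lemma wprod_single u i n : (forall j, j != i -> u j = 1%g) ->
  wprod u n = if (i < n)%N then u i else 1%g.
Proof.
move=> ui; elim: n => [|n IH] //=; rewrite IH ltnS.
case: insubP => [j _ jn|].
  have uj : (i != n :> nat) -> u j = 1%g.
    by move=> nin; apply: ui; rewrite -val_eqE /= jn eq_sym.
  case: (ltngtP i n) uj => [_ -> //|_ -> //|eq_in _]; rewrite ?mulg1 // mul1g.
  by congr (u _); apply: val_inj; rewrite /= jn eq_in.
rewrite -leqNgt => le_kn; rewrite mulg1 (leq_trans (ltn_ord i) le_kn).
by rewrite (leq_trans (ltnW (ltn_ord i)) le_kn).
Qed.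

(** This is the symmetry group in the coordinates in which it acts on inputs by translation. *)
Definition closed_words := 'ker (wprod^~ k).
Canonical closed_words_group := Eval hnf in [group of closed_words].

Lemma closed_words_sub : closed_words \subset Gk.
Proof. exact: subsetIl. Qed.

Lemma logn_closed_words : (e * k.-1 <= logn p #|closed_words|)%N.
Proof.
have /(congr1 (logn p)) := Lagrange closed_words_sub.
have := card_morphim (wprod_morphism k) Gk; rewrite setIid -/closed_words => <-.
rewrite lognM ?cardG_gt0 // card_Gk pfactorK // => eq_ek.
rewrite -subn1 mulnBr muln1 leq_subLR -eq_ek addnC leq_add2r.
rewrite -[leqRHS](pfactorK e p_pr) -oG leq_logn_card //.
by apply/subsetP=> _ /morphimP[u _ Gu ->]; apply: wprod_in.
Qed.

(** For [i] outside [S], a closed word supported at [i] alone is trivial. Inside [socle S] the layer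
    vectors thus miss the line of coordinate [i], which costs one dimension. For [S = setT] there is
    no such [i], whence the extra 1. *)
Lemma fixdim_closed_words t S : (#|S| + fixdim t closed_words S <= k.-1 + (S == setT))%N.
Proof.
case: eqP => [->|/eqP nS].
  rewrite cardsT card_ord (_ : fixdim _ _ _ = 0)%N; first by lia.
  apply/eqP; rewrite -leqn0.
  have := leq_logn_card p (subsetIr (layer t closed_words) (socle setT)).
  by rewrite card_socle setCT cards0 logn1.
have /subsetPn[i _ nSi] : ~~ ([set: 'I_k] \subset S) by rewrite subTset.
pose E := socle_group [set~ i]; pose K := (layer t closed_words :&: socle S)%G.
have KE1 : K :&: E = 1%g.
  apply/trivgP/subsetP=> u /setIP[/setIP[Lu Su] /socleP[_ Eu]].
  have /kerP-/(_ (subsetP (socle_sub_Gk S) _ Su)) /= : u \in closed_words.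
    exact: subsetP (layer_sub _ _) _ Lu.
  have ui j : j != i -> u j = 1%g by move=> nji; apply: Eu; rewrite !inE.
  rewrite (wprod_single _ ui) ltn_ord => ui1; rewrite inE; apply/eqP/ffunP=> j.
  by rewrite ffunE; case: (eqVneq j i) => [->|/ui].
have cKE : E \subset 'C(K).
  apply: (sub_abelian_cent2 Gk_abelian); first exact: socle_sub_Gk.
  exact: subset_trans (subsetIr _ _) (socle_sub_Gk S).
have := logn_cardMI p K E; rewrite KE1 cards1 logn1 addn0 -cent_joinEr //.
have sJ : K <*> E \subset socle S.
  rewrite join_subG subsetIr; apply/subsetP=> u /socleP[Ou Eu].
  apply/socleP; split=> // j Sj; apply: Eu; rewrite !inE.
  by apply: contraNneq nSi => <-.
have := leq_logn_card p sJ; rewrite !card_socle !pfactorK // setCK cards1.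
rewrite /= => leJ eqK; rewrite -eqK in leJ.
have {}leJ : (fixdim t closed_words S + 1 <= #|~: S|)%N := leJ.
have k_gt0 : (0 < k)%N := leq_ltn_trans (leq0n i) (ltn_ord i).
have kE := cardsC S; rewrite card_ord in kE.
by rewrite addn0 -ltnS prednK // -[leqRHS]kE ltn_add2l -addn1.
Qed.

Lemma balanced_closed_words :
  balanced [group of closed_words] (fun=> k%:R / e%:R) set0.
Proof.
move=> S _; rewrite /excess cards0 subr0 -!mulr_sumr -!natr_sum.
have -> : (\sum_(t < e) (0 + fixdim t closed_words set0) = logn p #|closed_words|)%N.
  by rewrite logn_sub_Gk // closed_words_sub.
have e0 : (e%:R : rat) != 0 by rewrite pnatr_eq0 -lt0n.
have leS : (\sum_(t < e) (#|S| + fixdim t closed_words S) <= e * (k.-1 + (S == setT)))%N.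
  rewrite -[X in (X * _)%N]card_ord -sum_nat_const; apply: leq_sum => t _.
  exact: fixdim_closed_words.
have leP := logn_closed_words.
have leR : (\sum_(t < e) (#|S| + fixdim t closed_words S) <=
     logn p #|closed_words| + e * (S == setT))%N by move: leS leP; lia.
have k0 : (0 : rat) <= k%:R / e%:R by rewrite divr_ge0 ?ler0n.
rewrite lerBlDr; move: leR; rewrite -(ler_nat rat) => /(ler_wpM2l k0)/le_trans; apply.
rewrite natrD mulrDr lerD2l natrM mulrA mulfVK // -natrM ler_nat.
(* Only [S = setT] has an extra term; with weights [k / e] it equals [k], which is exactly
   [#|S|]. *)
by case: eqP => [->|_]; rewrite ?cardsT ?card_ord; lia.
Qed.

End Power.

(** * Formula isomorphism *)

Lemma leq_sum_In (T : Type) (a : pred T) (E : T -> nat) (l : seq T) d :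
  List.In d l -> a d -> E d <= \sum_(x <- l | a x) E x.
Proof.
move=> ld ad; elim: l ld => //= x l IH [->|/IH le_d]; rewrite big_cons.
  by rewrite ad leq_addr.
by case: ifP => // _; apply: leq_trans le_d (leq_addl _ _).
Qed.

Lemma has_In (T : Type) (a : pred T) (l : seq T) : has a l -> exists2 x, List.In x l & a x.
Proof.
elim: l => //= x l IH /orP[ax|/IH[y ly ay]]; first by exists x; auto.
by exists y; auto.
Qed.

Lemma In_has (T : Type) (a : pred T) (l : seq T) x : List.In x l -> a x -> has a l.
Proof. by move=> lx ax; elim: l lx => //= y l IH [->|/IH ->]; rewrite ?ax ?orbT. Qed.

Section FormulaIso.
Variable V : Type.
Implicit Types (f g h : formula V) (l : seq (formula V)).

(** The induction principle generated for this nested type gives no hypothesis on the children in a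
    list. *)
Lemma formula_nested_ind (Q : formula V -> Prop) :
  (forall b, Q (FConst b)) -> (forall v b, Q (FLit v b)) ->
  (forall l, List.Forall Q l -> Q (FAnd l)) ->
  (forall l, List.Forall Q l -> Q (FOr l)) -> forall f, Q f.
Proof.
move=> Qc Ql Qa Qo; fix IH 1 => -[b|v b|l|l]; [exact: Qc|exact: Ql| |].
- by apply: Qa; elim: l => [|f l IHl]; constructor.
- by apply: Qo; elim: l => [|f l IHl]; constructor.
Qed.

Lemma fiso_nested_ind (R : formula V -> formula V -> Prop) :
  (forall b, R (FConst b) (FConst b)) -> (forall v s, R (FLit v s) (FLit v s)) ->
  (forall l1 l2 l3, Permutation.Permutation l2 l3 -> List.Forall2 R l1 l3 ->
     R (FAnd l1) (FAnd l2)) ->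
  (forall l1 l2 l3, Permutation.Permutation l2 l3 -> List.Forall2 R l1 l3 ->
     R (FOr l1) (FOr l2)) ->
  forall f g, fiso f g -> R f g.
Proof.
move=> Rc Rl Ra Ro; fix IH 3 => f g [b|v s|l1 l2 l3 p23 F13|l1 l2 l3 p23 F13];
  [exact: Rc|exact: Rl| |].
- by apply: (Ra _ _ _ p23); elim: F13 => [|x y l l' xy _ IHl]; constructor=> //; apply: IH.
- by apply: (Ro _ _ _ p23); elim: F13 => [|x y l l' xy _ IHl]; constructor=> //; apply: IH.
Qed.

Lemma fiso_refl f : fiso f f.
Proof.
have refl_list l : List.Forall (fun f => fiso f f) l -> List.Forall2 (@fiso V) l l.
  by elim: l => [|x l IH] // /List.Forall_cons_iff[? /IH]; constructor.
elim/formula_nested_ind: f => [b|v b|l|l] => [||/refl_list ?|/refl_list ?]; try constructor.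
- exact: fiso_and (Permutation.Permutation_refl l) _.
- exact: fiso_or (Permutation.Permutation_refl l) _.
Qed.

Lemma Forall2_perm (R : formula V -> formula V -> Prop) l1 l2 l3 :
  List.Forall2 R l1 l2 -> Permutation.Permutation l2 l3 ->
  exists2 l1', Permutation.Permutation l1 l1' & List.Forall2 R l1' l3.
Proof.
move=> /List.Forall2_flip F p23.
have [l1' [p11 F']] := Permutation.Permutation_Forall2 p23 F.
by exists l1' => //; apply: List.Forall2_flip.
Qed.

Lemma fiso_sym f g : fiso f g -> fiso g f.
Proof.
elim/fiso_nested_ind => [b|v s|l1 l2 l3 p23 F|l1 l2 l3 p23 F]; try constructor.
- have [l1' p1 F'] := Forall2_perm F (Permutation.Permutation_sym p23).
  exact: fiso_and p1 (List.Forall2_flip F').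
- have [l1' p1 F'] := Forall2_perm F (Permutation.Permutation_sym p23).
  exact: fiso_or p1 (List.Forall2_flip F').
Qed.

Lemma fiso_trans f g h : fiso f g -> fiso g h -> fiso f h.
Proof.
have trans_list l1 l2 l3 : List.Forall2 (fun f g => forall h, fiso g h -> fiso f h) l1 l2 ->
    List.Forall2 (@fiso V) l2 l3 -> List.Forall2 (@fiso V) l1 l3.
  move=> F; elim: F l3 => [|x y l l' xy _ IH] l3 G; inversion G; subst; constructor; auto.
move=> fg; elim/fiso_nested_ind: fg h => [b|v s|l1 l2 l3 p23 F|l1 l2 l3 p23 F] h //.
- move=> G; inversion G as [| |m1 m2 m3 q23 G13|]; subst.
  have [m3' [q3 G']] := Permutation.Permutation_Forall2 p23 G13.
  exact: fiso_and (Permutation.perm_trans q23 q3) (trans_list _ _ _ F G').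
- move=> G; inversion G as [| | |m1 m2 m3 q23 G13]; subst.
  have [m3' [q3 G']] := Permutation.Permutation_Forall2 p23 G13.
  exact: fiso_or (Permutation.perm_trans q23 q3) (trans_list _ _ _ F G').
Qed.

Lemma fiso_lit_inj (v w : V) s s' : fiso (FLit v s) (FLit w s') -> v = w.
Proof. by move=> iso; inversion iso. Qed.

Lemma Forall2_map (T : Type) (E : formula V -> T) l1 l2 :
  List.Forall2 (fun f g => E f = E g) l1 l2 -> map E l1 = map E l2.
Proof. by elim=> //= x y l l' -> _ ->. Qed.

Lemma perm_all_has (a : pred (formula V)) l1 l2 : Permutation.Permutation l1 l2 ->
  all a l1 = all a l2 /\ has a l1 = has a l2.
Proof.
elim=> //= [x l l' _ [-> ->] //|x y l|l l' l'' _ [-> ->] _ [-> ->] //].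
by split; [case: (a x); case: (a y)|case: (a x); case: (a y)].
Qed.

Lemma fiso_eval x f g : fiso f g -> feval x f = feval x g.
Proof.
elim/fiso_nested_ind => // l1 l2 l3 /(perm_all_has (feval x))[pa ph] /Forall2_map F /=.
- by rewrite pa -(all_map (feval x) id) F all_map.
- by rewrite ph -(has_map (feval x) id) F has_map.
Qed.

Lemma fiso_size f g : fiso f g -> fsize f = fsize g.
Proof.
have perm_size l1 l2 : Permutation.Permutation l1 l2 ->
    sumn (map (@fsize V) l1) = sumn (map (@fsize V) l2).
  elim=> //= [x l l' _ -> //|x y l|l l' l'' _ -> //]; exact: addnCA.
by elim/fiso_nested_ind => // l1 l2 l3 /perm_size p23 /Forall2_map F /=; rewrite p23 F.
Qed.

Lemma fiso_rename s f g : fiso f g -> fiso (frename s f) (frename s g).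
Proof.
have ren_list l1 l2 : List.Forall2 (fun f g => fiso (frename s f) (frename s g)) l1 l2 ->
    List.Forall2 (@fiso V) (map (frename s) l1) (map (frename s) l2).
  by elim=> [|x y l l' xy _ IH]; constructor.
elim/fiso_nested_ind => [b|v b|l1 l2 l3 p23 F|l1 l2 l3 p23 F] /=; try constructor.
- exact: fiso_and (Permutation.Permutation_map _ p23) (ren_list _ _ F).
- exact: fiso_or (Permutation.Permutation_map _ p23) (ren_list _ _ F).
Qed.

Lemma map_ext_Forall (T : Type) (a b : formula V -> T) l :
  List.Forall (fun f => a f = b f) l -> map a l = map b l.
Proof. by elim=> //= x l' -> _ ->. Qed.

Lemma frename_comp s1 s2 s3 f : (forall v, s1 (s2 v) = s3 v) ->
  frename s1 (frename s2 f) = frename s3 f.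
Proof.
move=> s123; elim/formula_nested_ind: f => [//|v b /=|l|l]; first by rewrite s123.
- by move=> /map_ext_Forall F; rewrite /= -map_comp F.
- by move=> /map_ext_Forall F; rewrite /= -map_comp F.
Qed.

Lemma frename_id s f : (forall v, s v = v) -> frename s f = f.
Proof.
move=> sid; elim/formula_nested_ind: f => [//|v b /=|l|l]; first by rewrite sid.
- by move=> /map_ext_Forall F; rewrite /= F map_id.
- by move=> /map_ext_Forall F; rewrite /= F map_id.
Qed.

Lemma feval_rename s x y f : (forall v, x (s v) = y v) ->
  feval x (frename s f) = feval y f.
Proof.
move=> sxy; elim/formula_nested_ind: f => [//|v b /=|l|l]; first by rewrite sxy.
- by move=> /map_ext_Forall F; rewrite /= all_map -(all_map _ id) F all_map.
- by move=> /map_ext_Forall F; rewrite /= has_map -(has_map _ id) F has_map.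
Qed.

Definition gate_children f := match f with FAnd l | FOr l => l | _ => [::] end.

Lemma fiso_children f g : fiso f g -> forall c, List.In c (gate_children f) ->
  exists2 c', List.In c' (gate_children g) & fiso c c'.
Proof.
have in_list l1 l2 l3 c : Permutation.Permutation l2 l3 -> List.Forall2 (@fiso V) l1 l3 ->
    List.In c l1 -> exists2 c', List.In c' l2 & fiso c c'.
  move=> p23 F c1.
  suff [c' c3 cc'] : exists2 c', List.In c' l3 & fiso c c'.
    by exists c' => //; apply: Permutation.Permutation_in c3; apply: Permutation.Permutation_sym.
  elim: F c1 {p23} => //= x y l l' xy _ IH [<-|/IH[c' ? ?]]; first by exists y; auto.
  by exists c'; auto.
by case=> // l1 l2 l3 p23 F c; apply: (in_list _ _ l3).
Qed.

Lemma fsize_children f : fsize f = \sum_(c <- gate_children f) fsize c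
  \/ gate_children f = [::].
Proof. by case: f => [b|v b|l|l]; [right|right|left|left]; rewrite //= sumnE big_map. Qed.

Lemma depth_child f c : List.In c (gate_children f) -> (fdepth c < fdepth f)%N.
Proof.
have in_list l : List.In c l -> (fdepth c <= foldr maxn 0 (map (@fdepth V) l))%N.
  elim: l => //= x l IH [->|/IH]; first exact: leq_maxl.
  by move=> /leq_trans; apply; apply: leq_maxr.
by case: f => //= l /in_list.
Qed.

End FormulaIso.

(** * Invariant formulas for the word problem *)

Section WordFormulas.
Variables (q p e k : nat) (G : {group {perm 'I_q}}).
Hypotheses (p_pr : prime p) (e_gt0 : 0 < e) (cG : cyclic G).
Hypotheses (oG : #|G| = (p ^ e)%N) (oq : #|G| = q).
Hypothesis (trG : [transitive G, on [set: 'I_q] | 'P]).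
Notation gTk := {dffun forall _ : 'I_k, {perm 'I_q}}.
Notation form := (formula (wvar k q)).
Implicit Types (U : {group gTk}) (u v h : gTk) (f : form).

Let abG : abelian G := cyclic_abelian cG.
Local Notation Gk := (@Gk _ k G).
Local Notation loops := (closed_words_group k cG).
Local Notation socle := (@socle _ k G).

Lemma regular_fix g a : g \in G -> g a = a -> g = 1.
Proof.
move=> Gg ga; have := card_orbit_stab 'P G a.
have /= := atransP trG a (in_setT a) => ->; rewrite cardsT card_ord oq => /eqP.
have q_gt0 : 0 < q by rewrite -[X in _ < X]oq cardG_gt0.
rewrite -[X in _ == X]muln1 eqn_pmul2l // => /eqP/card1_trivg stab1.
have : g \in 'C_G[a | 'P] by rewrite inE Gg; apply/astab1P.
by rewrite stab1 => /set1P.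
Qed.

Definition wtrans u : wvar k q -> wvar k q := wact (fun j => (wprod u j)^-1).

(** [gext] forces the value 1 at [0] and [k], where the partial products of a closed word are 1
    anyway. *)
Lemma gext_wprod u j : u \in loops -> j <= k ->
  gext k (fun j => (wprod u j)^-1) j = (wprod u j)^-1.
Proof.
move=> /[dup] Lu /kerP-/(_ (subsetP (closed_words_sub _ _) _ Lu)) /= uk le_jk.
rewrite /gext; case: j le_jk => [|j] le_jk /=; first by rewrite invg1.
case: ltnP => // ge_jk; have eq_jk : j.+1 = k by apply/eqP; rewrite eqn_leq le_jk.
by rewrite [(wprod u j * _)](_ : _ = wprod u j.+1) // eq_jk uk invg1.
Qed.

Lemma wtransM u v x : u \in loops -> v \in loops -> wtrans u (wtrans v x) = wtrans (u * v) x.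
Proof.
move=> Lu Lv; have Luv := groupM Lu Lv.
have sL := subsetP (closed_words_sub k cG).
case: x => [[i a] b]; rewrite /wtrans /wact !gext_wprod //; try exact: ltnW (ltn_ord i).
by rewrite !(wprodM cG _ (sL _ Lu) (sL _ Lv)) !invMg !permM.
Qed.

(** Relabeling conjugates [h i] by a partial product, which changes nothing in an abelian group, and
    multiplies it by [u i]. *)
Lemma assign_wtrans h u x : h \in Gk -> u \in loops ->
  permmx_assign h (wtrans u x) = permmx_assign (h * u) x.
Proof.
move=> /setXnP Gh Lu; have Gu := subsetP (closed_words_sub k cG) _ Lu.
case: x => [[i a] b]; rewrite /wtrans /wact /permmx_assign.
rewrite !gext_wprod //; try exact: ltnW (ltn_ord i).
rewrite ffunE /= valK; set P := wprod u i.
have GP : P \in G by apply: wprod_in.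
have hP : P^-1 * h i = h i * P^-1 by apply: (centsP abG); rewrite ?groupV.
rewrite -(inj_eq (@perm_inj _ (P * u i))) permKV -!permM.
by rewrite !mulgA hP mulgKV.
Qed.

Definition wstab U f := [set u in U | `[< fiso (frename (wtrans u) f) f >]].

Lemma frename_wtransM u v f : u \in loops -> v \in loops ->
  frename (wtrans u) (frename (wtrans v) f) = frename (wtrans (u * v)) f.
Proof. by move=> Lu Lv; apply: frename_comp => x; apply: wtransM. Qed.

Lemma wprod1 n : wprod (1 : gTk) n = 1.
Proof. by elim: n => //= n ->; case: insub => [j|]; rewrite ?ffunE mulg1. Qed.

Lemma frename_wtrans1 f : frename (wtrans 1) f = f.
Proof.
apply: frename_id => -[[i a] b]; rewrite /wtrans /wact !gext_wprod ?group1 //;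
  try exact: ltnW (ltn_ord i).
by rewrite !wprod1 invg1 !perm1.
Qed.

Lemma wstab_group_set U f : U \subset loops -> group_set (wstab U f).
Proof.
move=> sU; apply/group_setP; split=> [|u v].
  by rewrite inE group1; apply/asboolP; rewrite frename_wtrans1; apply: fiso_refl.
rewrite !inE => /andP[Uu /asboolP fu] /andP[Uv /asboolP fv]; rewrite groupM //.
apply/asboolP; rewrite -frename_wtransM ?(subsetP sU) //.
exact: fiso_trans (fiso_rename _ fv) fu.
Qed.

(** Count pairs of [u] in [U] and a child [d] isomorphic to the translate of [c] by [u]. Each [u]
    has such a [d], of the same size as [c]; for each [d] the possible [u] lie in one left coset of
    the stabilizer of [c]. *)
Lemma orbit_size U f c : U \subset loops ->
  (forall u, u \in U -> fiso (frename (wtrans u) f) f) ->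
  List.In c (gate_children f) -> #|U| * fsize c <= #|wstab U c| * fsize f.
Proof.
move=> sU inv_f fc.
have [->|f0] := fsize_children f; last by rewrite f0 in fc.
pose near u d := `[< fiso (frename (wtrans u) c) d >].
have orbit_in u : u \in U -> fsize c <= \sum_(d <- gate_children f | near u d) fsize d.
  move=> Uu.
  have [d fd cd] : exists2 d, List.In d (gate_children f) & fiso (frename (wtrans u) c) d.
    apply: (fiso_children (inv_f u Uu)).
    by case: (f) fc => //= l; apply: List.in_map.
  have -> : fsize c = fsize d.
    rewrite -(fiso_size cd); elim/formula_nested_ind: (c) => //= l IH; congr sumn.
      by rewrite -map_comp; apply: map_ext_Forall.
    by rewrite -map_comp; apply: map_ext_Forall.
  by apply: leq_sum_In fd _; apply/asboolP.
have := leq_sum (index_enum _) orbit_in; rewrite sum_nat_const => /leq_trans; apply.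
under eq_bigr do rewrite big_mkcond.
rewrite exchange_big big_distrr /=; apply: leq_sum => d _.
rewrite -big_mkcondr sum_nat_const leq_mul2r; apply/orP; right.
have [/existsP[u0 /andP[Uu0 /asboolP u0d]]|none] :=
  boolP [exists u, (u \in U) && near u d]; last first.
  rewrite (_ : #|_| = 0) //; apply: eq_card0 => u; apply: contraNF none => ud.
  by apply/existsP; exists u.
rewrite -(card_lcoset (wstab U c) u0); apply: subset_leq_card; apply/subsetP=> u.
rewrite mem_lcoset => /andP[Uu /asboolP ud]; rewrite inE groupM ?groupV //.
apply/asboolP; rewrite -frename_wtransM ?groupV ?(subsetP sU) //.
have := fiso_rename (wtrans u0^-1) (fiso_trans ud (fiso_sym u0d)).
by rewrite !frename_wtransM ?groupV ?(subsetP sU) // mulVg frename_wtrans1.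
Qed.

(** * Induction along a path of the formula *)

Local Open Scope ring_scope.

(** The intended [s] lists the layer drops met on a path to a leaf, [e] of them per gate. *)
Definition size_bound f (mu : 'I_e -> rat) := exists s : seq nat,
  [/\ (size s <= e * fdepth f)%N, \prod_t (e%:R * mu t) <= (\prod_(c <- s) c.+1)%:R
    & (p ^ sumn s <= fsize f)%N].

(** The induction hypothesis; the group, the weights, [Z] and the two inputs are quantified since
    they may all change on the way down. *)
Definition node_bound f := forall U mu Z (x y : gTk),
  U \subset loops -> (forall u, u \in U -> fiso (frename (wtrans u) f) f) ->
  x \in Gk -> y \in Gk -> feval (permmx_assign x) f != feval (permmx_assign y) f ->
  (x^-1 * y)%g \in socle Z -> (forall t, 0 < mu t) -> balanced p G U mu Z ->
  size_bound f mu.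

Lemma loops_sub : loops \subset Gk.
Proof. exact: closed_words_sub. Qed.

(* Keeping [x] fixed, the point [y] may be moved by [U]: the child [c] separates
   [x] from all of [y U]. *)
Lemma gate_bound f c U (mu : 'I_e -> rat) Z (x y : gTk) :
  List.In c (gate_children f) -> node_bound c ->
  U \subset loops -> (forall u, u \in U -> fiso (frename (wtrans u) f) f) ->
  x \in Gk -> y \in Gk ->
  (forall u, u \in U ->
     feval (permmx_assign x) c != feval (permmx_assign (y * u)%g) c) ->
  (x^-1 * y)%g \in socle Z -> (forall t, 0 < mu t) -> balanced p G U mu Z ->
  size_bound f mu.
Proof.
move=> fc IHc sU inv_f Gx Gy sep Zxy mu_gt0 balU.
pose U' := Group (wstab_group_set c sU).
have sU' : U' \subset U by apply/subsetP=> u; rewrite inE => /andP[].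
have sUG := subset_trans sU loops_sub.
have [u [Z' [Uu Zu balU']]] := balanced_step p_pr cG oG e_gt0 sUG sU' Zxy mu_gt0 balU.
set mu' := fun t : 'I_e => _ in balU'.
have Gyu : (y * u)%g \in Gk by rewrite groupM // (subsetP sUG).
have [|||s [ds ms ps]] :=
  IHc U' mu' Z' x (y * u)%g (subset_trans sU' sU) _ Gx Gyu (sep u Uu) _ _ balU'.
- by move=> v; rewrite inE => /andP[_ /asboolP].
- by rewrite mulgA.
- by move=> t; rewrite divr_gt0 ?mu_gt0 ?ltr0n.
exists (s ++ [seq layer_drop p G U U' t | t : 'I_e <- enum 'I_e]); split.
- rewrite size_cat size_map size_enum_ord.
  apply: (@leq_trans (e * (fdepth c).+1)%N); first by rewrite mulnS addnC leq_add2l.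
  by rewrite leq_mul2l depth_child ?orbT.
- rewrite big_cat big_map /= natrM big_enum /=.
  have -> : \prod_t (e%:R * mu t) =
      \prod_t (e%:R * mu' t) * \prod_(t < e) (layer_drop p G U U' t).+1%:R.
    by rewrite -big_split; apply: eq_bigr => t _ /=; rewrite -mulrA /mu' mulfVK // pnatr_eq0.
  by rewrite [X in _ <= _ * X]natr_prod ler_pM2r //; apply: prodr_gt0 => t _; rewrite ltr0n.
rewrite sumn_cat expnD [sumn (map _ _)]sumnE big_map big_enum /=.
have := orbit_size sU inv_f fc.
rewrite (card_layer_drop p_pr cG oG sUG sU') -mulnA mulnCA leq_pmul2l ?cardG_gt0 //.
by apply: leq_trans; rewrite mulnC leq_mul2l ps orbT.
Qed.

Lemma all_node_bound f : node_bound f.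
Proof.
have In_Forall (Q : form -> Prop) l c : List.Forall Q l -> List.In c l -> Q c.
  by move=> /List.Forall_forall; apply.
have inv_eval U g : U \subset loops -> (forall u, u \in U -> fiso (frename (wtrans u) g) g) ->
    forall u x, u \in U -> x \in Gk ->
    feval (permmx_assign (x * u)%g) g = feval (permmx_assign x) g.
  move=> sU inv_g u x Uu Gx; rewrite -(fiso_eval (permmx_assign x) (inv_g u Uu)).
  apply/esym/feval_rename => v.
  by rewrite assign_wtrans ?(subsetP sU).
elim/formula_nested_ind: f => [b|[[i a] b] s|l IH|l IH]
  U mu Z x y sU inv_f Gx Gy sep Zxy mu_gt0 balU.
- by rewrite eqxx in sep.
- exists [::]; rewrite /= big_nil muln0; split=> //.
  apply: (@balanced_leaf _ p e k G e_gt0 U mu Z i) => //.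
    apply/negP => Zi; have [_ /(_ i Zi)] := socleP _ _ _ Zxy.
    rewrite !ffunE => /eqP; rewrite -eq_mulVg1 => /eqP xyi.
    by move: sep; rewrite /= xyi eqxx.
  (* Fixing the literal makes the partial products before and after position [i] fix a point, hence
     equal 1 by regularity; they differ by the factor [u i]. *)
  move=> u Uu; have Lu := subsetP sU u Uu; have := inv_f u Uu.
  rewrite /= /wtrans /wact !gext_wprod //; try exact: ltnW (ltn_ord i).
  have Gp n : wprod u n \in G by apply: wprod_in; apply: subsetP loops_sub _ Lu.
  move=> iso; have [ea eb] := fiso_lit_inj iso.
  have wE : wprod u i.+1 = (wprod u i * u i)%g by rewrite /= valK.
  have w0 n z : (wprod u n)^-1%g z = z -> wprod u n = 1%g.
    by move=> /regular_fix wz; apply/invg_inj; rewrite wz ?groupV ?invg1.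
  by move: (w0 i.+1 b eb); rewrite wE (w0 i a ea) mul1g.
(* Some child is false at [x']. By invariance the gate, and with it this child, is true on the whole
   coset of [y']. The OR case is dual. *)
- have child_bound (x' y' : gTk) : x' \in Gk -> y' \in Gk -> (x'^-1 * y')%g \in socle Z ->
      feval (permmx_assign x') (FAnd l) = false -> feval (permmx_assign y') (FAnd l) ->
      size_bound (FAnd l) mu.
    move=> Gx' Gy' Z' /negbT /=; rewrite -has_predC => /has_In[c lc /= xc] yl.
    apply: (gate_bound (c := c) _ (In_Forall _ _ _ IH lc) sU inv_f Gx' Gy' _ Z' mu_gt0 balU) => //.
    move=> u Uu; rewrite (negPf xc) eq_sym eqbF_neg negbK.
    have /= := inv_eval _ _ sU inv_f u y' Uu Gy'; rewrite [RHS]yl => yul.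
    by apply: contraTT yul => nc; rewrite -has_predC (In_has lc).
  case ex: (feval (permmx_assign x) (FAnd l)) sep => sep.
    apply: (child_bound y x) => //; last by move: sep; case: feval.
    by rewrite -groupV invMg invgK.
  by apply: (child_bound x y) => //; move: sep; case: feval.
have child_bound (x' y' : gTk) : x' \in Gk -> y' \in Gk -> (x'^-1 * y')%g \in socle Z ->
    feval (permmx_assign x') (FOr l) -> feval (permmx_assign y') (FOr l) = false ->
    size_bound (FOr l) mu.
  move=> Gx' Gy' Z' /= /has_In[c lc xc] yl.
  apply: (gate_bound (c := c) _ (In_Forall _ _ _ IH lc) sU inv_f Gx' Gy' _ Z' mu_gt0 balU) => //.
  move=> u Uu; rewrite xc eq_sym eqb_id.
  have /= := inv_eval _ _ sU inv_f u y' Uu Gy'; rewrite [RHS]yl => yul.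
  by apply: contraFN yul => /(In_has lc).
case ex: (feval (permmx_assign x) (FOr l)) sep => sep.
  by apply: (child_bound x y) => //; move: sep; case: feval.
apply: (child_bound y x) => //; last by move: sep; case: feval.
by rewrite -groupV invMg invgK.
Qed.

(** * The word problem on tuples of permutations *)

Lemma wrow_assign (a0 : 'I_q) h m b : val a0 = 0%N -> (m <= k)%N ->
  wrow (permmx_assign h) m b = (wprod h m a0 == b).
Proof.
move=> a0E; elim: m b => [|m IH] b le_mk /=; first by rewrite perm1 -val_eqE /= a0E eq_sym.
rewrite /wentry insubT permM.
apply/existsP/eqP => [[a /andP[]]|<-].
  by rewrite IH ?(ltnW le_mk) // => /eqP <- /eqP.
by exists (wprod h m a0); rewrite IH ?(ltnW le_mk) //= !eqxx.
Qed.

Lemma word_assign (a0 : 'I_q) h : val a0 = 0%N ->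
  word (permmx_assign h) = (wprod h k a0 == a0).
Proof.
move=> a0E; apply/existsP/eqP => [[b /andP[/eqP b0]]|ha0].
  by rewrite (wrow_assign h b a0E) // => /eqP ->; apply: val_inj; rewrite b0.
by exists a0; rewrite (wrow_assign h a0 a0E) // ha0 a0E !eqxx.
Qed.

Lemma word_size_bound f : (0 < k)%N -> word_invariant G f -> computes_word G f ->
  exists s : seq nat, [/\ (size s <= e * fdepth f)%N,
    (k ^ e <= \prod_(c <- s) c.+1)%N & (p ^ sumn s <= fsize f)%N].
Proof.
move=> k_gt0 inv_f comp_f.
have q_gt0 : (0 < q)%N by rewrite -[X in (_ < X)%N]oq cardG_gt0.
pose a0 : 'I_q := Ordinal q_gt0; pose i0 : 'I_k := Ordinal k_gt0.
have [z Oz z1] : exists2 z, z \in 'Ohm_1(G) & z != 1%g.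
  apply/trivgPn; rewrite trivg_card1 (card_Ohm1G p_pr cG oG e_gt0).
  by rewrite gtn_eqF // prime_gt1.
(* The inputs compared are 1 and this word, whose product [z] has order [p] and moves [a0] by
   regularity. *)
pose y : gTk := [ffun i => if i == i0 then z else 1%g].
have Sy : y \in socle set0.
  by apply/socleP; split=> i; rewrite ?inE // ffunE; case: ifP.
have Gy : y \in Gk := subsetP (socle_sub_Gk _ _) _ Sy.
have evE h : h \in Gk -> feval (permmx_assign h) f = (wprod h k a0 == a0).
  by move=> /setXnP Gh; rewrite comp_f // (@word_assign a0).
have [|||||||s [ds ms ps]] := @all_node_bound f loops (fun=> k%:R / e%:R) set0 1%g y (subxx _).
- by move=> u Lu; apply: inv_f => j _; rewrite groupV wprod_in // (subsetP loops_sub).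
- exact: group1.
- exact: Gy.
- rewrite !evE // wprod1 perm1 eqxx (@wprod_single _ _ y i0) ?ltn_ord; last first.
    by move=> j /negPf j0; rewrite ffunE j0.
  rewrite ffunE eqxx eq_sym eqb_id; apply: contra z1 => /eqP za.
  by rewrite (regular_fix _ za) // (subsetP (Ohm_sub 1 G)).
- by rewrite invg1 mul1g.
- by move=> _; rewrite divr_gt0 ?ltr0n.
- exact: balanced_closed_words.
exists s; split=> //; move: ms.
rewrite (eq_bigr (fun=> k%:R)) => [|t _]; last by rewrite mulrC mulfVK // pnatr_eq0 -lt0n.
by rewrite prodr_const card_ord -natrX ler_nat.
Qed.

End WordFormulas.

(** * Real estimates *)

Section RealBounds.
Local Open Scope R_scope.

Lemma INR_expn m n : INR (expn m n) = pow (INR m) n.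
Proof. by elim: n => [|n IH]; rewrite ?expn0 // expnS -multE mult_INR IH. Qed.

Lemma leq_INR m n : leq m n -> INR m <= INR n.
Proof. by move=> /ssrnat.leP; apply: le_INR. Qed.

Lemma INR_gt0 m : leq 1 m -> 0 < INR m.
Proof. by move=> /ssrnat.leP; apply: lt_0_INR. Qed.

Lemma ln_pow_INR m n : leq 1 m -> ln (INR (expn m n)) = INR n * ln (INR m).
Proof. by move=> m_gt0; rewrite INR_expn ln_pow //; apply: INR_gt0. Qed.

Lemma ln_le_sub1 x : 0 < x -> ln x <= x - 1.
Proof. by move=> x_gt0; have := exp_ineq1_le (ln x); rewrite exp_ln //; Lra.lra. Qed.

Lemma ln_leq m n : leq 1 m -> leq m n -> ln (INR m) <= ln (INR n).
Proof.
move=> m_gt0 le_mn; case: (Rle_lt_or_eq_dec _ _ (leq_INR le_mn)) => [lt_mn|->].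
  by apply/Rlt_le/ln_increasing => //; apply: INR_gt0.
exact: Rle_refl.
Qed.

Lemma prod_succ_gt0 (s : seq nat) : leq 1 (\prod_(c <- s) c.+1)%N.
Proof. by apply: prodn_gt0. Qed.

Lemma prod_succ_leq_exp2 (s : seq nat) : leq (\prod_(c <- s) c.+1)%N (expn 2 (sumn s)).
Proof.
elim: s => [|c s IH]; first by rewrite big_nil.
by rewrite big_cons /= expnD leq_mul // ltn_expl.
Qed.

(* Summing the tangent-line inequality [x >= a (1 + ln (x / a))] over [x = c + 1]. *)
Lemma sum_succ_tangent a (s : seq nat) : 0 < a ->
  a * (INR (size s) + ln (INR (\prod_(c <- s) c.+1)%N) - INR (size s) * ln a)
  <= INR (sumn s) + INR (size s).
Proof.
move=> a_gt0; elim: s => [|c s IH]; first by rewrite big_nil /= ln_1; Lra.lra.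
rewrite big_cons -multE mult_INR ln_mult; [|exact: INR_gt0|exact/INR_gt0/prod_succ_gt0].
have c_gt0 : 0 < INR c.+1 by apply: INR_gt0.
have := ln_le_sub1 (Rdiv_lt_0_compat _ _ c_gt0 a_gt0).
rewrite /Rdiv ln_mult ?ln_Rinv //; last exact: Rinv_0_lt_compat.
move=> /(Rmult_le_compat_l a _ _ (Rlt_le _ _ a_gt0)).
rewrite Rmult_minus_distr_l Rmult_1_r (_ : a * (INR c.+1 * / a) = INR c.+1); last by field; Lra.lra.
rewrite [size _]/= [sumn _]/= -plusE plus_INR !S_INR; move: IH.
by set L := ln (INR (\prod_(j <- s) _)%N); Lra.nra.
Qed.

Lemma Rpower_prime_power_le p e n m T : (1 < p)%N -> (p ^ n <= m)%N ->
  INR e * T <= INR n -> Rpower (INR (expn p e)) T <= INR m.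
Proof.
move=> p_gt1 le_m leT; have p_gt0 : leq 1 p by apply: ltnW.
apply: Rle_trans (leq_INR le_m).
rewrite /Rpower ln_pow_INR // -[X in _ <= X]exp_ln; last by apply: INR_gt0; rewrite expn_gt0 p_gt0.
have lnp : 0 <= ln (INR p) by rewrite -ln_1; apply: (@ln_leq 1).
have leT' := Rmult_le_compat_r _ _ _ lnp leT.
rewrite ln_pow_INR //; case: (Rle_lt_or_eq_dec _ _ leT') => [lt|eqT].
  by apply/Rlt_le/exp_increasing; Lra.lra.
by right; congr exp; Lra.lra.
Qed.

Lemma log2_bound e k (s : seq nat) : (0 < k)%N -> (k ^ e <= \prod_(c <- s) c.+1)%N ->
  INR e * (ln (INR k) / ln 2) <= INR (sumn s).
Proof.
move=> k_gt0 le_k; have ln2_gt0 : 0 < ln 2 by rewrite -ln_1; apply: ln_increasing; Lra.lra.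
have ke_gt0 : leq 1 (expn k e) by rewrite expn_gt0 k_gt0.
have := ln_leq ke_gt0 (leq_trans le_k (prod_succ_leq_exp2 s)).
rewrite !ln_pow_INR // (_ : INR 2 = 2) // => le_ln.
apply: (Rmult_le_reg_r (ln 2)) => //.
by rewrite (_ : _ * _ * ln 2 = INR e * ln (INR k)) //; field; Lra.lra.
Qed.

Lemma depth_bound e d k (s : seq nat) : (0 < k)%N -> (0 < d)%N -> (size s <= e * d)%N ->
  (k ^ e <= \prod_(c <- s) c.+1)%N ->
  INR e * (INR d * (Rpower (INR k) (/ INR d) - 1)) <= INR (sumn s).
Proof.
move=> k_gt0 d_gt0 /leq_INR size_s le_k.
have d_gt0R := INR_gt0 d_gt0.
(* [a] is the common value of [c + 1] when [e * d] equal factors multiply to [k ^ e]; the tangent is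
   taken there. *)
set a := Rpower _ _; have a_gt0 : 0 < a by apply: exp_pos.
have lna : ln a * INR d = ln (INR k) by rewrite /a /Rpower ln_exp; field; Lra.lra.
have lnk : 0 <= ln (INR k) by rewrite -ln_1; apply: (@ln_leq 1).
have lna_ge0 : 0 <= ln a.
  by apply: (Rmult_le_reg_r (INR d)) => //; rewrite lna Rmult_0_l.
have ke_gt0 : leq 1 (expn k e) by rewrite expn_gt0 k_gt0.
have := ln_leq ke_gt0 le_k; rewrite ln_pow_INR // -lna => le_prod.
have tangent := sum_succ_tangent s a_gt0.
(* This is the tangent inequality at [c = 0]; it pads [s] with zeros when it has fewer than [e * d]
   entries. *)
have ainv : a - 1 <= a * ln a.
  have := ln_le_sub1 (Rinv_0_lt_compat _ a_gt0); rewrite ln_Rinv // => le_inv.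
  have := Rmult_le_compat_l a _ _ (Rlt_le _ _ a_gt0) le_inv.
  by rewrite Rmult_minus_distr_l Rinv_r; Lra.lra.
move: size_s; rewrite -multE mult_INR => size_s.
set L := ln (INR _) in le_prod tangent; set n := INR (size s) in size_s tangent.
have := Rmult_le_compat_l a _ _ (Rlt_le _ _ a_gt0) le_prod.
have : 0 <= INR e * INR d - n by Lra.lra.
move=> /Rmult_le_compat_l/(_ ainv).
by Lra.nra.
Qed.

End RealBounds.

Theorem theorem1p4 (q : nat) (G : {group {perm 'I_q}}) :
  prime_power q ->
  cyclic G -> #|G| = q -> [transitive G, on [set: 'I_q] | 'P] ->
  forall k d : nat, 0 < k -> 0 < d ->
    (forall f : formula (wvar k q),
        word_invariant G f -> computes_word G f ->
        Rle (Rpower (INR q) (Rdiv (ln (INR k)) (ln 2))) (INR (fsize f)))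
    /\
    (forall f : formula (wvar k q),
        word_invariant G f -> computes_word G f -> fdepth f <= d ->
        Rle (Rpower (INR q) (Rmult (INR d) (Rminus (Rpower (INR k) (Rinv (INR d))) 1)))
            (INR (fsize f))).
Proof.
move=> [p [e [p_pr [e_gt0 qE]]]] cG oq trG k d k_gt0 d_gt0.
have oG : #|G| = (p ^ e)%N := etrans oq qE.
have bound := word_size_bound p_pr e_gt0 cG oG oq trG k_gt0.
have INRq : INR q = INR (expn p e) by rewrite -qE.
split=> f inv_f comp_f; have [s [size_s prod_s pow_s]] := bound f inv_f comp_f.
  rewrite INRq; apply: Rpower_prime_power_le (prime_gt1 p_pr) pow_s _.
  exact: log2_bound prod_s.
move=> depth_f; rewrite INRq; apply: Rpower_prime_power_le (prime_gt1 p_pr) pow_s _.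
apply: depth_bound prod_s => //; apply: leq_trans size_s _.
by rewrite leq_mul2l depth_f orbT.
Qed.
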